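(* Let $L,N\ge 0$ be integers with $2L\le 2N+1$, let $\{\tilde\Phi_\ell\}_{\ell\ge 0}$ be the normalized orthogonal polynomials with respect to the weight function $w$ on $[-1,1]$, let $x_0,\dots,x_N$ be the zeros of $\tilde\Phi_{N+1}$ and $\omega_0,\dots,\omega_N$ the corresponding Gauss quadrature weights. Let $f\in\mathcal C([-1,1])$ and $0\le\mu_0\le\mu_1\le\dots\le\mu_L$. Let $\boldsymbol\beta=[\beta_0,\beta_1,\dots,\beta_L]^T$ be the solution to the $\ell_1$-regularized problem $$\min_{\boldsymbol\beta\in\mathbb R^{L+1}}\ \|\mathbf W^{1/2}(\mathbf A_L\boldsymbol\beta-\mathbf f)\|_2^2+\lambda\|\mathbf R_L\boldsymbol\beta\|_1.$$ If $\lambda>0$, then the number of nonzero elements of $\boldsymbol\beta$ satisfies $$\|\boldsymbol\beta\|_0\le\|\mathbf A_L^T\mathbf W\mathbf f\|_0$$ and $$\|\boldsymbol\beta\|_0=\|\mathbf A_L^T\mathbf W\mathbf f\|_0-\#\{\ell\in\{0,1,\dots,L\}:\ \beta_\ell=0\text{ but }\alpha_\ell\ne0\},$$ where $\alpha_\ell=\sum_{j=0}^N\omega_j\tilde\Phi_\ell(x_j)f(x_j)$.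
   Context: The weight function $w:(-1,1)\to\mathbb R$ is positive with $\int_{-1}^1 w(x)\,dx<\infty$ and $\int_{-1}^1x^iw(x)\,dx<\infty$ for $i=1,2,\dots$. $\tilde\Phi_\ell$ is a polynomial of degree $\ell$, and $\int_{-1}^1w(x)\tilde\Phi_\ell(x)\tilde\Phi_{\ell'}(x)\,dx=\delta_{\ell,\ell'}$. The Gauss quadrature weights $\omega_j>0$ are those for which $\sum_{j=0}^N\omega_jp(x_j)=\int_{-1}^1w(x)p(x)\,dx$ for all polynomials $p$ of degree at most $2N+1$. $\mathbf A_L=[\tilde\Phi_\ell(x_j)]\in\mathbb R^{(N+1)\times(L+1)}$ (row index $j=0,\dots,N$, column index $\ell=0,\dots,L$), $\mathbf W=\mathrm{diag}(\omega_0,\dots,\omega_N)$, $\mathbf f=[f(x_0),\dots,f(x_N)]^T$, $\mathbf R_L=\mathrm{diag}(\mu_0,\dots,\mu_L)$. For a vector $\mathbf v$, $\|\mathbf v\|_0$ denotes the number of nonzero entries of $\mathbf v$. *)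

(* Defs.v *)
From HB Require Import structures.
From mathcomp Require Import all_boot all_order all_algebra.
From mathcomp Require Import all_classical all_reals all_analysis.

Set Implicit Arguments.
Unset Strict Implicit.
Unset Printing Implicit Defensive.

Import Order.TTheory GRing.Theory Num.Theory.
Import numFieldNormedType.Exports.

Local Open Scope classical_set_scope.
Local Open Scope ring_scope.

Section Defs.
Context {R : realType}.

(* The weight lives on the open interval ]-1, 1[; values of w elsewhere are
   never used. As w is positive, the case i = 0 of integrability says exactly
   that w is measurable with finite integral; for odd i, a finite moment is
   read as absolute integrability. *)
Definition weight_function (w : R -> R) : Prop :=
  [/\ forall x, -1 < x < 1 -> 0 < w x,
      lebesgue_measure.-integrable `]-1, 1[ (fun x => (w x)%:E)
    & forall i : nat, (0 < i)%N ->
      lebesgue_measure.-integrable `]-1, 1[ (fun x => (x ^+ i * w x)%:E)].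

(* The sign of each Phi l is not normalized. *)
Definition orthonormal_polys (w : R -> R) (Phi : nat -> {poly R}) : Prop :=
  (forall l, size (Phi l) = l.+1) /\
  (forall l l', (\int[lebesgue_measure]_(x in `](-1)%R, 1%R[)
                   (w x * (Phi l).[x] * (Phi l').[x])%R%:E
                 = ((l == l')%:R : R)%:E)%E).

Definition zeros_of (p : {poly R}) (n : nat) (x : 'I_n -> R) : Prop :=
  injective x /\ forall t : R, root p t <-> exists j, x j = t.

Definition gauss_weights (w : R -> R) (N : nat)
    (x omega : 'I_N.+1 -> R) : Prop :=
  (forall j, 0 < omega j) /\
  (forall p : {poly R}, (size p <= (2 * N + 1).+1)%N ->
     ((\sum_(j < N.+1) omega j * p.[x j])%R%:E
      = \int[lebesgue_measure]_(t in `](-1)%R, 1%R[) (w t * p.[t])%R%:E)%E).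

Definition norm1 (n : nat) (v : 'cV[R]_n) : R := \sum_i `|v i 0|.
Definition norm2 (n : nat) (v : 'cV[R]_n) : R := Num.sqrt (\sum_i v i 0 ^+ 2).
Definition norm0 (n : nat) (v : 'cV[R]_n) : nat := #|[set i | v i 0 != 0]%SET|.

Definition A_mx (Phi : nat -> {poly R}) (N L : nat) (x : 'I_N.+1 -> R) :
  'M[R]_(N.+1, L.+1) := \matrix_(j, l) (Phi l).[x j].

Definition W_mx (N : nat) (omega : 'I_N.+1 -> R) : 'M[R]_N.+1 :=
  diag_mx (\row_j omega j).

Definition W_half_mx (N : nat) (omega : 'I_N.+1 -> R) : 'M[R]_N.+1 :=
  diag_mx (\row_j Num.sqrt (omega j)).

Definition f_vec (N : nat) (x : 'I_N.+1 -> R) (f : R -> R) : 'cV[R]_N.+1 :=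
  \col_j f (x j).

Definition R_mx (L : nat) (mu : 'I_L.+1 -> R) : 'M[R]_L.+1 :=
  diag_mx (\row_l mu l).

Definition l1_objective (Phi : nat -> {poly R}) (N L : nat)
    (x omega : 'I_N.+1 -> R) (f : R -> R) (mu : 'I_L.+1 -> R) (lambda : R)
    (b : 'cV[R]_L.+1) : R :=
  norm2 (W_half_mx omega *m (A_mx Phi L x *m b - f_vec x f)) ^+ 2
  + lambda * norm1 (R_mx mu *m b).

Definition is_minimizer (T : Type) (J : T -> R) (b : T) : Prop :=
  forall b', J b <= J b'.

Definition alpha (Phi : nat -> {poly R}) (N : nat)
    (x omega : 'I_N.+1 -> R) (f : R -> R) (l : nat) : R :=
  \sum_(j < N.+1) omega j * (Phi l).[x j] * f (x j).

End Defs.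

(* Main.v *)
Require Import Defs.
From HB Require Import structures.
From mathcomp Require Import all_boot all_order all_algebra.
From mathcomp Require Import all_classical all_reals all_analysis.
From mathcomp Require Import ring.

(** The Gauss rule with N+1 nodes is exact in degree 2N+1, hence on every
    product of two of the polynomials of degree at most L, because 2L <= 2N+1.
    So these polynomials stay orthonormal for the discrete inner product with
    nodes x_j and weights omega_j, that is A^T W A = 1 ([gauss_gram_mx]).

    Expanding the square then removes all interaction between coordinates: up
    to a constant, the objective is the sum over l of
      b_l ^ 2 - 2 alpha_l b_l + lambda |mu_l b_l|     ([l1_objective_separable]),
    so that each entry of a minimizer minimizes its own summand.  When
    alpha_l = 0 the summand is at least b_l ^ 2 and vanishes at 0, which forces
    beta_l = 0 ([minimizer_coef_eq0]).  The support of beta is therefore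
    contained in the support of A^T W f, whose entries are the alpha_l; both
    claims count the complement of the first support in the second. *)

Set Implicit Arguments.
Unset Strict Implicit.
Unset Printing Implicit Defensive.

Import Order.TTheory GRing.Theory Num.Theory.
Import numFieldNormedType.Exports.

Local Open Scope classical_set_scope.
Local Open Scope ring_scope.

(** * Discrete orthonormality under the Gauss rule *)

Section GaussOrthonormality.
Variables (R : realType) (w : R -> R) (Phi : nat -> {poly R}) (N : nat).
Variables (x omega : 'I_N.+1 -> R).
Hypothesis hPhi : orthonormal_polys w Phi.
Hypothesis homega : gauss_weights w x omega.

(** The product of the two polynomials has degree l + l', so the rule
    integrates it exactly. *)
Lemma gauss_orthonormal (l l' : nat) : (l + l' <= 2 * N + 1)%N ->
  \sum_(j < N.+1) omega j * ((Phi l).[x j] * (Phi l').[x j]) = (l == l')%:R.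
Proof.
move=> hll'; case: hPhi => hsize hortho; case: homega => _ hexact.
have hdeg : (size (Phi l * Phi l')%R <= (2 * N + 1).+1)%N.
  by apply: leq_trans (size_polyMleq _ _) _; rewrite !hsize addSn addnS /= ltnS.
have := hexact _ hdeg.
under eq_integral do rewrite hornerM mulrA.
rewrite hortho => -[] <-.
by apply: eq_bigr => j _; rewrite hornerM.
Qed.

Lemma gauss_gram_mx (L : nat) : (2 * L <= 2 * N + 1)%N ->
  (A_mx Phi L x)^T *m W_mx omega *m A_mx Phi L x = 1%:M.
Proof.
move=> hLN; apply/matrixP => k l; rewrite !mxE -val_eqE /= -gauss_orthonormal.
  by apply: eq_bigr => j _; rewrite mul_mx_diag !mxE mulrA [X in X * _]mulrC.
apply: leq_trans hLN; rewrite mul2n -addnn.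
by apply: leq_add; rewrite -ltnS ltn_ord.
Qed.

End GaussOrthonormality.

(** * The regularized objective in coordinates *)

Section Objective.
Variables (R : realType) (Phi : nat -> {poly R}) (N L : nat).
Variables (x omega : 'I_N.+1 -> R) (f : R -> R).

Lemma alphaE (l : 'I_L.+1) :
  ((A_mx Phi L x)^T *m W_mx omega *m f_vec x f) l 0 = alpha Phi x omega f l.
Proof.
rewrite !mxE; apply: eq_bigr => j _.
by rewrite mul_mx_diag !mxE [X in X * _]mulrC.
Qed.

Lemma norm2_W_half_mx (v : 'cV[R]_N.+1) : (forall j, 0 < omega j) ->
  norm2 (W_half_mx omega *m v) ^+ 2 = (v^T *m W_mx omega *m v) 0 0.
Proof.
move=> omega_gt0; rewrite sqr_sqrtr; last by apply: sumr_ge0 => j _; exact: sqr_ge0.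
rewrite mxE; apply: eq_bigr => j _.
rewrite mul_diag_mx mul_mx_diag !mxE exprMn sqr_sqrtr ?ltW //.
by rewrite mulrAC mulrC expr2.
Qed.

(** Orthonormality of the columns of A turns the quadratic form b^T A^T W A b
    into b^T b, the only place where distinct entries of b could meet. *)
Lemma l1_objective_separable (mu : 'I_L.+1 -> R) (lambda : R)
    (b : 'cV[R]_L.+1) :
  (forall j, 0 < omega j) ->
  (A_mx Phi L x)^T *m W_mx omega *m A_mx Phi L x = 1%:M ->
  l1_objective Phi x omega f mu lambda b
  = ((f_vec x f)^T *m W_mx omega *m f_vec x f) 0 0
    + \sum_l (b l 0 ^+ 2 - 2 * alpha Phi x omega f l * b l 0
              + lambda * `|mu l * b l 0|).
Proof.
move=> omega_gt0 hgram; rewrite /l1_objective norm2_W_half_mx //.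
set A := A_mx Phi L x; set W := W_mx omega; set F := f_vec x f.
pose c := A^T *m W *m F.
have quadE : (A *m b)^T *m W *m (A *m b) = b^T *m b.
  by rewrite trmx_mul -!mulmxA (mulmxA W) (mulmxA A^T) mulmxA (mulmxA A^T) hgram mulmx1.
have crossE : (A *m b)^T *m W *m F = b^T *m c.
  by rewrite trmx_mul /c !mulmxA.
(* W is symmetric, so the second cross term is the transpose of the first. *)
have crossE' : F^T *m W *m (A *m b) = c^T *m b.
  by rewrite /c !trmx_mul trmxK tr_diag_mx !mulmxA.
have -> : (A *m b - F)^T *m W *m (A *m b - F)
        = b^T *m b - c^T *m b - b^T *m c + F^T *m W *m F.
  rewrite mulmxBr [(_ - _)^T]linearB /= !mulmxBl quadE crossE crossE'.
  by rewrite opprB addrA addrAC.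
move: (F^T *m W *m F) => q.
rewrite !mxE /norm1 mulr_sumr -!sumrB addrAC addrC -big_split /=.
congr (_ + _); apply: eq_bigr => l _.
rewrite /R_mx mul_diag_mx !mxE -alphaE -/c.
by congr (_ + _); rewrite !mxE; ring.
Qed.

End Objective.

(** * Minimizers *)

(** Changing one entry of b changes one summand only. *)
Lemma separable_minimizer_coord (R : realType) (n : nat) (J : 'cV[R]_n -> R)
    (C : R) (h : 'I_n -> R -> R) (b : 'cV[R]_n) :
  (forall b', J b' = C + \sum_i h i (b' i 0)) -> is_minimizer J b ->
  forall i t, h i (b i 0) <= h i t.
Proof.
move=> JE bmin i t.
have := bmin (\col_k if k == i then t else b k 0).
rewrite !JE lerD2l (bigD1 i) //= [X in _ <= X](bigD1 i) //= mxE eqxx.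
rewrite [X in _ <= _ + X](eq_bigr (fun k => h k (b k 0))) ?lerD2r //.
by move=> k /negPf ki; rewrite mxE ki.
Qed.

(** The summand of an index with alpha_l = 0 is b_l ^ 2 plus a nonnegative
    penalty; comparing with its value 0 at b_l = 0 leaves b_l ^ 2 <= 0. *)
Lemma minimizer_coef_eq0 (R : realType) (Phi : nat -> {poly R}) (N L : nat)
    (x omega : 'I_N.+1 -> R) (f : R -> R) (mu : 'I_L.+1 -> R) (lambda : R)
    (b : 'cV[R]_L.+1) (l : 'I_L.+1) :
  (forall j, 0 < omega j) ->
  (A_mx Phi L x)^T *m W_mx omega *m A_mx Phi L x = 1%:M ->
  0 <= lambda -> is_minimizer (l1_objective Phi x omega f mu lambda) b ->
  alpha Phi x omega f l = 0 -> b l 0 = 0.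
Proof.
move=> omega_gt0 hgram lambda_ge0 bmin alpha0.
have := separable_minimizer_coord
  (h := fun k t => t ^+ 2 - 2 * alpha Phi x omega f k * t
                   + lambda * `|mu k * t|)
  (fun b' => l1_objective_separable f mu lambda b' omega_gt0 hgram) bmin l 0.
rewrite alpha0 !mulr0 normr0 !mulr0 mul0r subr0 expr0n /= subr0 addr0 => le0.
apply/eqP; rewrite -sqrf_eq0 eq_le sqr_ge0 andbT.
by apply: le_trans le0; rewrite lerDl mulr_ge0.
Qed.

Theorem theorem4p1 (R : realType) (L N : nat) (hLN : (2 * L <= 2 * N + 1)%N)
  (w : R -> R) (hw : weight_function w)
  (Phi : nat -> {poly R}) (hPhi : orthonormal_polys w Phi)
  (x omega : 'I_N.+1 -> R)
  (hx : zeros_of (Phi N.+1) x) (homega : gauss_weights w x omega)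
  (f : R -> R) (hf : {within `[-1, 1], continuous f})
  (mu : 'I_L.+1 -> R) (hmu0 : 0 <= mu ord0)
  (hmu : forall i j : 'I_L.+1, (i <= j)%N -> mu i <= mu j)
  (lambda : R) (hlambda : 0 < lambda)
  (beta : 'cV[R]_L.+1)
  (hbeta : is_minimizer (l1_objective Phi x omega f mu lambda) beta) :
  (norm0 beta <= norm0 ((A_mx Phi L x)^T *m W_mx omega *m f_vec x f))%N
  /\ (norm0 beta)%:Z
     = (norm0 ((A_mx Phi L x)^T *m W_mx omega *m f_vec x f))%:Z
       - (#|[set l : 'I_L.+1 |
               (beta l 0 == 0) && (alpha Phi x omega f l != 0)]%SET|)%:Z.
Proof.
have [omega_gt0 _] := homega.
have hgram := gauss_gram_mx hPhi homega hLN.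
set Z := (X in _ /\ _ = _ - (#|X|)%:Z).
have card_split :
    norm0 ((A_mx Phi L x)^T *m W_mx omega *m f_vec x f) = (norm0 beta + #|Z|)%N.
  rewrite /norm0 -(cardsID [set l | beta l 0 != 0]%SET); congr (_ + _)%N.
    apply: eq_card => l; rewrite !inE alphaE andbC.
    case: eqP => //= beta_neq0; apply/eqP => alpha0; apply: beta_neq0.
    exact: minimizer_coef_eq0 omega_gt0 hgram (ltW hlambda) hbeta alpha0.
  by apply: eq_card => l; rewrite !inE alphaE negbK.
by rewrite card_split leq_addr PoszD addrK.
Qed.
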